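(* For any integers $n$ and $k$ with $2\leq k\leq \lfloor n/2 \rfloor$, $$\gamma_{oitR}(C(n,k))=n-\left\lfloor\frac{\left\lfloor \frac{n}{k+1} \right\rfloor}{2}\right\rfloor.$$
   Context: For integers $n$ and $0<k\leq\lfloor n/2\rfloor$, $C(n,k)$ denotes the circulant graph with vertex set $\{v_0,v_1,\ldots,v_{n-1}\}$ in which each $v_i$ is adjacent to $v_{i+j}$ and $v_{i-j}$ for $j=1,\ldots,k$, subscripts taken modulo $n$ (as a simple graph). For a graph $G$ with no isolated vertex and a function $f:V(G)\to\{0,1,2\}$, let $V_i=\{v\in V(G): f(v)=i\}$ for $i\in\{0,1,2\}$. The function $f$ is an outer-independent total Roman dominating function on $G$ if (i) every vertex in $V_0$ is adjacent to at least one vertex in $V_2$; (ii) $V_0$ is an independent set; and (iii) the subgraph induced by $V_1\cup V_2$ has no isolated vertex. The outer-independent total Roman domination number $\gamma_{oitR}(G)$ is the minimum weight $\omega(f)=\sum_{v\in V(G)}f(v)$ among all such functions. *)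

(* Defs.v *)
From mathcomp Require Import all_boot.

Set Implicit Arguments.
Unset Strict Implicit.
Unset Printing Implicit Defensive.

Record sgraph := SGraph {
  vertex :> finType;
  adj : rel vertex;
  adj_sym : symmetric adj;
  adj_irr : irreflexive adj }.

Section Domination.
Variable G : sgraph.
Implicit Types (S : {set G}) (f : {ffun G -> 'I_3}).

Definition independent S := [forall u in S, forall v in S, ~~ adj u v].

(* The subgraph of G induced by S has no isolated vertex. *)
Definition isolate_free S := [forall u in S, exists v in S, adj u v].

Definition level f (i : nat) : {set G} := [set v | (f v : nat) == i].

Definition oitRDF f :=
  [&& [forall v in level f 0, exists u in level f 2, adj v u],
      independent (level f 0)
    & isolate_free (level f 1 :|: level f 2)].

Definition weight f := \sum_(v : G) (f v : nat).

Definition const1 : {ffun G -> 'I_3} := [ffun=> inord 1].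

Lemma oitRDF_const1 : isolate_free [set: G] -> oitRDF const1.
Proof.
move=> /forallP iso.
have lev i : level const1 i = if i == 1 then setT else set0.
  by apply/setP=> v; rewrite !inE ffunE inordK // eq_sym; case: eqP; rewrite inE.
rewrite /oitRDF !lev /= setU0; apply/and3P; split; last exact/forallP.
  by apply/forallP=> v; rewrite inE.
by apply/forallP=> v; rewrite inE.
Qed.

(* The constant function 1 only seeds the search for a minimizer; it is itself
   admissible when G has no isolated vertex, the only case in which the
   parameter is meaningful (see gamma_oitRP). *)
Definition gamma_oitR : nat :=
  weight [arg min_(f < const1 | oitRDF f) weight f].

Lemma gamma_oitRP : isolate_free [set: G] ->
  (exists2 f, oitRDF f & weight f = gamma_oitR) /\
  (forall f, oitRDF f -> gamma_oitR <= weight f).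
Proof.
move=> /oitRDF_const1 h1; rewrite /gamma_oitR.
by case: arg_minnP => // f hf fmin; split; first by exists f.
Qed.

End Domination.

Section Circulant.
Variables n k : nat.

(* v = u + j or v = u - j modulo n for some 1 <= j <= k; the second congruence
   is written v + j = u to avoid truncated subtraction. *)
Definition circ_adj : rel 'I_n := fun u v =>
  (u != v) &&
  [exists j : 'I_k.+1, (0 < j) &&
     ((v == u + j %[mod n]) || (v + j == u %[mod n]))].

Lemma circ_adj_sym : symmetric circ_adj.
Proof.
move=> u v; rewrite /circ_adj eq_sym; congr (_ && _).
by apply: eq_existsb => j; rewrite orbC eq_sym [X in _ || X]eq_sym.
Qed.

Lemma circ_adj_irr : irreflexive circ_adj.
Proof. by move=> u; rewrite /circ_adj eqxx. Qed.

Definition circulant : sgraph := SGraph circ_adj_sym circ_adj_irr.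

Lemma circulant_isolate_free :
  0 < k -> k <= n./2 -> isolate_free [set: circulant].
Proof.
move=> k0 kn; have n1 : 1 < n.
  by rewrite -half_gt0; apply: leq_trans kn.
apply/forallP=> u; apply/implyP=> _; apply/existsP.
have n0 : 0 < n by apply: ltnW.
exists (Ordinal (ltn_pmod u.+1 n0)); rewrite inE /= /circ_adj.
apply/andP; split; last first.
  apply/existsP; exists (inord 1); rewrite inordK ?ltnS //=.
  by rewrite modn_mod addn1 eqxx.
apply/eqP=> /(congr1 val) /= e.
have /eqP : u + 0 = u + 1 %[mod n] by rewrite addn0 addn1 -e modn_small.
by rewrite eqn_modDl mod0n modn_small.
Qed.

End Circulant.

(* Main.v *)
(* Since weight f = n - #|V0| + #|V2|, one has to maximise #|V0| - #|V2|. The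
   arcs {v, ..., v + k}, v in V0, are disjoint because V0 is independent, so
   #|V0| <= n / (k + 1); and C(n, k) is claw-free, so a vertex of V2 has at most
   two neighbours in V0, whence #|V0| <= 2 * #|V2|. Conversely, take V0 to
   consist of the first 2p multiples of k + 1, where 2p (k + 1) <= n, and V2 of
   the vertices 2 i (k + 1) + 1, i < p. *)
Require Import Defs.
From mathcomp Require Import all_boot zify.

Set Implicit Arguments.
Unset Strict Implicit.
Unset Printing Implicit Defensive.

(** Vertex by vertex, a value 0, 1 or 2 plus [[f v = 0]] equals 1 plus [[f v = 2]]. The additive
    form avoids truncated subtraction. *)
Lemma weight_levels (G : sgraph) (f : {ffun G -> 'I_3}) :
  weight f + #|level f 0| = #|G| + #|level f 2|.
Proof.
rewrite -!sum1_card [X in _ + X]big_mkcond [X in _ = _ + X]big_mkcond.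
rewrite -!big_split /=; apply: eq_bigr => v _; rewrite !inE.
by case: (f v) => [[|[|[|i]]]].
Qed.

Lemma independentP (G : sgraph) (S : {set G}) :
  reflect {in S &, forall u v, ~~ adj u v} (independent S).
Proof.
apply: (iffP forall_inP) => [h u v uS vS|h u uS].
  by move/forall_inP: (h u uS); apply.
by apply/forall_inP => v vS; apply: h.
Qed.

Definition claw_free (G : sgraph) := forall u a b c : G,
  adj u a -> adj u b -> adj u c -> a != b -> b != c -> c != a ->
  [|| adj a b, adj b c | adj c a].

(** The neighbourhoods of V2 cover V0, and three neighbours in V0 of one vertex would form a claw,
    since V0 is independent. *)
Lemma claw_free_level0_le (G : sgraph) (f : {ffun G -> 'I_3}) :
  claw_free G -> oitRDF f -> #|level f 0| <= 2 * #|level f 2|.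
Proof.
move=> cf /and3P[/forall_inP dom /independentP ind _].
pose B u : {set G} := [set v in level f 0 | adj u v].
have sub : level f 0 \subset \bigcup_(u in level f 2) B u.
  apply/subsetP => v v0; have /exists_inP[u u2 vu] := dom v v0.
  by apply/bigcupP; exists u => //; rewrite inE v0 adj_sym.
apply: leq_trans (subset_leq_card sub) _.
have union_bound (L : {set G}) : #|\bigcup_(u in L) B u| <= \sum_(u in L) #|B u|.
  elim/big_ind2: _ => [|A1 m1 A2 m2 h1 h2|//]; first by rewrite cards0.
  by apply: leq_trans (leq_card_setU _ _) _; apply: leq_add.
apply: leq_trans (union_bound _) _.
rewrite mulnC -sum_nat_const; apply: leq_sum => u _.
rewrite leqNgt; apply/card_gt2P => -[a [b [c [[]]]]].
rewrite !inE => /andP[a0 ua] /andP[b0 ub] /andP[c0 uc] [ab bc ca].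
have := cf u a b c ua ub uc ab bc ca.
by rewrite !(negPf (ind _ _ _ _)) ?inE.
Qed.

Section Circulant.
Variables n k : nat.
Hypotheses (k2 : 2 <= k) (kn : k <= n %/ 2).

(** A sum below [2n] wraps at most once, so congruences become linear conditions within reach of
    [lia]. *)
Lemma eqn_mod_small2 x y : x < n -> y < n + n ->
  (x == y %[mod n]) = (x == y) || (x + n == y).
Proof.
move=> xn yn; rewrite (modn_small xn).
have [{}yn|ny] := ltnP y n; first by rewrite modn_small //; lia.
by rewrite -(subnK ny) modnDr modn_small; lia.
Qed.

(** The cyclic arc of [k + 1] vertices starting at [u], with [u] included; the second disjunct is
    the part that wraps past 0. *)
Definition ahead (u v : 'I_n) := (u <= v <= u + k) || (v + n <= u + k).

Lemma circ_adjE u v : circ_adj k u v = (u != v) && (ahead u v || ahead v u).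
Proof.
rewrite /circ_adj /ahead; have [//|uv /=] := eqVneq u v.
have {uv} : val u != val v by [].
have [un vn] := (ltn_ord u, ltn_ord v); move=> /= uv.
have circE (j : 'I_k.+1) :
    ((v == u + j %[mod n]) || (v + j == u %[mod n])) =
    [|| v == u + j :> nat, v + n == u + j, u == v + j :> nat | u + n == v + j].
  have jk := ltn_ord j.
  by rewrite [X in _ || X]eq_sym !eqn_mod_small2 ?orbA; lia.
apply/existsP/idP => [[j]|h]; first by rewrite circE; have := ltn_ord j; lia.
(* The step [d] is the cyclic distance between [u] and [v]; the four cases fix its direction and
   whether it wraps. *)
have witness (d : nat) : 0 < d <= k ->
    [|| v == u + d :> nat, v + n == u + d, u == v + d :> nat | u + n == v + d] ->
    exists j : 'I_k.+1, (0 < j) &&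
      ((v == u + j %[mod n]) || (v + j == u %[mod n])).
  by move=> /andP[d0 dk] hd; exists (inord d); rewrite circE inordK ?d0 ?ltnS.
case/orP: h => /orP[] h.
- by apply: (witness (v - u)); lia.
- by apply: (witness (v + n - u)); lia.
- by apply: (witness (u - v)); lia.
by apply: (witness (u + n - v)); lia.
Qed.

Lemma ahead_adj u a b : ahead u a -> ahead u b -> a != b -> circ_adj k a b.
Proof.
rewrite circ_adjE => + + ab; rewrite ab /ahead.
have [[un an] bn] := (ltn_ord u, ltn_ord a, ltn_ord b).
by case/orP => ?; case/orP => ?; lia.
Qed.

Lemma behind_adj u a b : ahead a u -> ahead b u -> a != b -> circ_adj k a b.
Proof.
rewrite circ_adjE => + + ab; rewrite ab /ahead.
have [[un an] bn] := (ltn_ord u, ltn_ord a, ltn_ord b).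
by case/orP => ?; case/orP => ?; lia.
Qed.

(* Two of three neighbours of u lie on the same side of u. *)
Lemma circulant_claw_free : claw_free (circulant n k).
Proof.
move=> u a b c /=; rewrite 3!(circ_adjE u) => /andP[_ ua] /andP[_ ub] /andP[_ uc].
move=> ab bc ca.
by case/orP: ua => ua; case/orP: ub => ub; case/orP: uc => uc; apply/or3P;
  first [ constructor 1; (exact: ahead_adj ua ub ab || exact: behind_adj ua ub ab)
        | constructor 2; (exact: ahead_adj ub uc bc || exact: behind_adj ub uc bc)
        | constructor 3; (exact: ahead_adj uc ua ca || exact: behind_adj uc ua ca) ].
Qed.

Lemma circulant_independent_card (S : {set circulant n k}) :
  independent S -> #|S| <= n %/ (k + 1).
Proof.
move=> /independentP ind; have n0 : 0 < n by lia.
(* The goal becomes [#|S| * (k + 1) <= n], proved by injecting the pairs (start, offset) into the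
   vertices. *)
rewrite leq_divRL ?addn1 // -[k.+1]card_ord -cardsT -cardsX -[leqRHS]card_ord.
pose arc (p : 'I_n * 'I_k.+1) := Ordinal (ltn_pmod (p.1 + p.2) n0).
apply: (@leq_card_in _ _ arc) => -[v i] [w j] /setXP[vS _] /setXP[wS _].
move/(congr1 val) => /= /eqP e.
have := ind v w vS wS; rewrite /= circ_adjE /ahead.
have [vn wn ik jk] : [/\ v < n, w < n, i < k.+1 & j < k.+1].
  by split; apply: ltn_ord.
have [evw _|] := eqVneq v w.
  rewrite evw; congr pair; apply: val_inj => /=.
  by move: e; rewrite evw eqn_modDl !modn_small; lia.
rewrite -val_eqE /= => vw; move: e.
(* If two arcs meet, their starts differ cyclically by the difference of two offsets, hence by at
   most [k]: they are adjacent. *)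
have [vi|nvi] := ltnP (v + i) n; have [wj|nwj] := ltnP (w + j) n.
- by rewrite !modn_small //; lia.
- by rewrite eqn_mod_small2; lia.
- by rewrite eq_sym eqn_mod_small2; lia.
by rewrite -(subnK nvi) -(subnK nwj) !modnDr !modn_small; lia.
Qed.

(** As [k >= 2], every vertex [v] lies in the triangle [v], [v + 1], [v + 2], so it keeps a
    neighbour outside an independent V0. *)
Lemma circulant_independent_isolate_free (f : {ffun circulant n k -> 'I_3}) :
  independent (level f 0) -> isolate_free (level f 1 :|: level f 2).
Proof.
move=> /independentP ind.
have lev v : (v \in level f 1 :|: level f 2) = (v \notin level f 0).
  by rewrite !inE; case: (f v) => [[|[|[|i]]]].
apply/forall_inP => v _.
(* v + 1 and v + 2 are adjacent, so at most one of them is in V0 *)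
have [a [b [va vb ab]]] : exists a b : 'I_n,
    [/\ circ_adj k v a, circ_adj k v b & circ_adj k a b].
  have shift i : i < n ->
      exists w : 'I_n, w = (if v + i < n then v + i else v + i - n) :> nat.
    move=> ilt; have vn : v < n := ltn_ord v.
    have wn : (if v + i < n then v + i else v + i - n) < n by case: ifP; lia.
    by exists (Ordinal wn).
  have [|a aE] := shift 1; first by lia.
  have [|b bE] := shift 2; first by lia.
  have vn : v < n := ltn_ord v.
  exists a, b; rewrite !circ_adjE /ahead -!val_eqE /= aE bE.
  by split; case: ifP => ?; try case: ifP => ?; lia.
have [a0|a0] := boolP (a \in level f 0); apply/exists_inP.
  exists b => //; rewrite lev; apply/negP => b0.
  by have := ind _ _ a0 b0; rewrite /= ab.
by exists a => //; rewrite lev.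
Qed.

End Circulant.

Lemma circulant_oitRDF_exists n k : 2 <= k -> k <= n %/ 2 ->
  exists2 f : {ffun circulant n k -> 'I_3},
    oitRDF f & weight f <= n - (n %/ (k + 1)) %/ 2.
Proof.
case: n => [|n] k2 kn; first by lia.
set p := (_ %/ _) %/ 2.
have pn : p * 2 * (k + 1) <= n.+1.
  by rewrite -leq_divRL; [exact: leq_divM | lia].
have gap x y : x < y -> x * (k + 1) + (k + 1) <= y * (k + 1).
  by move=> xy; rewrite -mulSnr leq_mul2r xy orbT.
pose a (i : 'I_(p * 2)) : circulant n.+1 k := inord (i * (k + 1)).
pose b (i : 'I_p) : circulant n.+1 k := inord (i * 2 * (k + 1) + 1).
have aE i : a i = i * (k + 1) :> nat.
  by rewrite inordK //; have := ltn_ord i; nia.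
have bE i : b i = i * 2 * (k + 1) + 1 :> nat.
  by rewrite inordK //; have := ltn_ord i; nia.
(* The residues modulo [k + 1] are 0 and 1. *)
have ab i j : a i != b j.
  rewrite -val_eqE /= aE bE; apply/eqP => /(congr1 (modn^~ (k + 1))).
  by rewrite modnMl modnMDl modn_small; lia.
pose f : {ffun circulant n.+1 k -> 'I_3} :=
  [ffun v => if v \in codom a then inord 0
             else if v \in codom b then inord 2 else inord 1].
have level0E : level f 0 = [set a i | i : 'I_(p * 2)].
  apply/setP => v; rewrite inE ffunE; apply/eqP/imsetP.
    case: ifP => [/codomP[i ->] _|_]; first by exists i.
    by case: ifP; rewrite inordK.
  by case=> i _ ->; rewrite codom_f inordK.
have level2E : level f 2 = [set b i | i : 'I_p].
  apply/setP => v; rewrite inE ffunE; apply/eqP/imsetP.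
    case: ifP => _; first by rewrite inordK.
    by case: ifP => [/codomP[i ->] _|_]; [exists i | rewrite inordK].
  case=> i _ ->; rewrite codom_f; case: ifP => [/codomP[j e]|_].
    by have := ab j i; rewrite e eqxx.
  by rewrite inordK.
have ind : independent (level f 0).
  apply/independentP => u v; rewrite level0E => /imsetP[i _ ->] /imsetP[j _ ->].
  rewrite /= circ_adjE // /ahead !aE -val_eqE /= !aE.
  (* The arcs from [a i] and [a j] end before [n], which rules out adjacency around 0. *)
  have := gap _ _ (ltn_ord i); have := gap _ _ (ltn_ord j).
  have [/gap|/gap|->] := ltngtP i j; last by rewrite eqxx.
    by move: (i * _) (j * _) (p * 2 * _) pn => x y z; lia.
  by move: (i * _) (j * _) (p * 2 * _) pn => x y z; lia.
exists f.
  apply/and3P; split=> //; last exact: circulant_independent_isolate_free.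
  apply/forall_inP => v; rewrite level0E => /imsetP[i _ ->].
  (* Consecutive zeros are paired: [b (i %/ 2)] is at distance 1 from [a i] for even [i] and at
     distance [k] for odd [i]. *)
  have ip : i %/ 2 < p by have := ltn_ord i; lia.
  apply/exists_inP; exists (b (Ordinal ip)); first by rewrite level2E imset_f.
  rewrite /= circ_adjE // /ahead -val_eqE /= aE bE /=.
  have -> : i * (k + 1) = i %/ 2 * 2 * (k + 1) + i %% 2 * (k + 1).
    by rewrite -mulnDl -divn_eq.
  move: (_ %/ 2 * 2 * _) => m.
  by case: (i %% 2) (ltn_pmod i (isT : 0 < 2)) => [|[|//]] _; lia.
have level2_le : #|level f 2| <= p.
  by rewrite level2E -[leqRHS]card_ord leq_imset_card.
have := weight_levels f; rewrite level0E card_ord card_imset; last first.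
  move=> i j /(congr1 val) /=; rewrite !aE => e.
  by apply: val_inj; apply/eqP; move/eqP: e; rewrite eqn_pmul2r ?addn1.
by rewrite card_ord; lia.
Qed.

Theorem theorem3p3 (n k : nat) (hk : 2 <= k) (hkn : k <= n %/ 2) :
  gamma_oitR (circulant n k) = n - (n %/ (k + 1)) %/ 2.
Proof.
have [|[f fdom <-] gmin] := @gamma_oitRP (circulant n k).
  by apply: circulant_isolate_free; [lia | rewrite -divn2].
have [g gdom gw] := circulant_oitRDF_exists hk hkn.
apply/eqP; rewrite eqn_leq (leq_trans (gmin g gdom) gw) /=.
have /and3P[_ ind _] := fdom.
(* With [z = #|V0|], the weight is at least [n - z] plus half of [z] rounded up, that is
   [n - z %/ 2], and [z <= n %/ (k + 1)]. *)
have := weight_levels f; rewrite card_ord.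
have := claw_free_level0_le (circulant_claw_free hk hkn) fdom.
have := circulant_independent_card hk hkn ind.
lia.
Qed.
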